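(* Let $A\in\mathbb{C}^{n\times n}$ be a Hermitian matrix with eigenvalues $\lambda_1\le\cdots\le\lambda_n$ and with diagonal entries listed in non-decreasing order as $d_1\le\cdots\le d_n$. If $A$ satisfies the strict majorization condition $$\lambda_1+\cdots+\lambda_k<d_1+\cdots+d_k\quad (k=1,\dots,n-1),\qquad \lambda_1+\cdots+\lambda_n=d_1+\cdots+d_n,$$ then $A$ is strongly Schur-Horn continuous (in the Hermitian sense).
   Context: $\|\cdot\|_{\mathrm F}$ is the Frobenius norm; $\mathrm{diag}(M)$ is the vector of diagonal entries of a matrix $M$; $M^*$ is the conjugate transpose. Big-$O$ convention: $\varepsilon>0$ is the asymptotic variable tending to zero; perturbed quantities are families indexed by sufficiently small $\varepsilon>0$; all other data (matrix dimension, the matrix $A$) are constants. Definition (strong Schur-Horn continuity for Hermitian matrices). Suppose $A\in\mathbb{C}^{n\times n}$ is a Hermitian matrix with an eigendecomposition $A=Q\Lambda Q^*$, where $Q$ is the unitary eigenvector matrix and $\Lambda$ is the diagonal eigenvalue matrix. $A$ is strongly Schur-Horn continuous if, for any perturbed eigenvalues $\widetilde\Lambda$ (a real diagonal matrix) satisfying $\mathrm{tr}(\widetilde\Lambda)=\mathrm{tr}(\Lambda)$ and $\|\widetilde\Lambda-\Lambda\|_{\mathrm F}=O(\varepsilon)$ for $\varepsilon>0$ sufficiently small, there exists a Hermitian matrix $\widetilde B=G_2QG_1\widetilde\Lambda G_1^* Q^* G_2^*$ such that (1) $\mathrm{diag}(\widetilde B)=\mathrm{diag}(A)$; (2) $G_1$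 and $G_2$ are unitary matrices; (3) $\|G_i-I\|_{\mathrm F}=O(\varepsilon^{1/2})$ for $i=1,2$. *)

(* Defs.v *)
From HB Require Import structures.
From mathcomp Require Import all_boot all_order all_algebra.
From mathcomp Require Import complex.
From mathcomp Require Import all_classical all_reals all_analysis.

Set Implicit Arguments.
Unset Strict Implicit.
Unset Printing Implicit Defensive.

Import Order.TTheory GRing.Theory Num.Theory.
Import numFieldNormedType.Exports.

Local Open Scope classical_set_scope.
Local Open Scope ring_scope.
Local Open Scope complex_scope.
Local Open Scope sesquilinear_scope.

Definition frobenius_norm (R : realType) (m n : nat) (M : 'M[R[i]]_(m, n)) : R :=
  Num.sqrt (\sum_i \sum_j Normc.normc (M i j) ^+ 2).

Definition diag_entries (K : Type) (n : nat) (M : 'M[K]_n) : 'rV[K]_n :=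
  \row_i M i i.

Definition real_diag_mx (R : realType) (n : nat) (L : 'rV[R]_n) : 'M[R[i]]_n :=
  diag_mx (\row_i (L 0 i)%:C).

(* lam lists the eigenvalues of A with algebraic multiplicity. *)
Definition eigenvalues_listed (R : realType) (n : nat) (A : 'M[R[i]]_n)
    (lam : n.-tuple R) : Prop :=
  char_poly A = \prod_(x <- lam) ('X - (x%:C)%:P).

Definition diagonal_listed (R : realType) (n : nat) (A : 'M[R[i]]_n)
    (d : n.-tuple R) : Prop :=
  perm_eq [seq x%:C | x <- d] [seq A i i | i <- enum 'I_n].

Definition strict_majorization (R : realType) (n : nat) (lam d : n.-tuple R) :
    Prop :=
  (forall k : nat, (1 <= k <= n.-1)%N ->
     \sum_(i < k) lam`_i < \sum_(i < k) d`_i) /\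
  \sum_(i < n) lam`_i = \sum_(i < n) d`_i.

(* The property is required of every eigendecomposition of A, with unitary Q
   and eigenvalues L in any order. Families are total functions of e, but only
   their values for small e > 0 (the filter 0^'+) are constrained; the
   constants hidden in the big-O may depend on the family Lt. *)
Definition strongly_Schur_Horn_continuous (R : realType) (n : nat)
    (A : 'M[R[i]]_n) : Prop :=
  A \is hermsymmx /\
  forall (Q : 'M[R[i]]_n) (L : 'rV[R]_n),
    Q \is unitarymx -> A = Q *m real_diag_mx L *m Q^t* ->
  forall Lt : R -> 'rV[R]_n,
    (\forall e \near 0^'+, \tr (real_diag_mx (Lt e)) = \tr (real_diag_mx L)) ->
    (fun e => frobenius_norm (real_diag_mx (Lt e) - real_diag_mx L))
      =O_ (0^'+) (fun e : R => e) ->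
  exists G1 G2 : R -> 'M[R[i]]_n,
    [/\ \forall e \near 0^'+,
          [/\ G1 e \is unitarymx, G2 e \is unitarymx &
            let B := G2 e *m Q *m G1 e *m real_diag_mx (Lt e)
                       *m (G1 e)^t* *m Q^t* *m (G2 e)^t* in
            B \is hermsymmx /\ diag_entries B = diag_entries A],
        (fun e => frobenius_norm (G1 e - 1%:M))
          =O_ (0^'+) (fun e : R => Num.sqrt e) &
        (fun e => frobenius_norm (G2 e - 1%:M))
          =O_ (0^'+) (fun e : R => Num.sqrt e)].

(* Main.v *)
(* Only the second rotation is needed: take [G1 = 1] and correct the diagonal of
   [C = Q Lt Q^*], which is [O(e)]-close to [A], by a unitary that is
   [O(eta)]-close to [1], where [eta = sqrt e].

   Join [i] and [j] when [A i j != 0]. Across such an edge a plane rotation of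
   angle [O(eta)] moves any amount [O(eta)] of diagonal mass, in either direction
   (intermediate value theorem); hence every error of size [O(eta)] can be removed
   inside each connected component that has the right trace. Between two different
   components, if unit vectors [v], [w] supported on them satisfy
   [v A v^* < w A w^*], then rotating the plane of [v] and [w] by an angle [O(eta)]
   moves exactly the prescribed mass [t = O(eta^2)] from the component of [w] to that
   of [v]; the side effects inside the components are [O(eta)] and are removed as
   before.

   If some index could not receive mass from some other index, the indices would
   split into a union of components [Y] and its complement, with [A <= m] on [Y] and
   [m <= A] on the complement for some threshold [m]. Then the trace of [A] on [Y] is
   the sum of the [#|Y|] smallest eigenvalues, against strict majorization. So
   any correction of size [O(e)] with zero sum is possible. *)

Require Import Defs.
From mathcomp Require Import all_boot all_order all_algebra.
From mathcomp Require Import complex.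
From mathcomp Require Import all_classical all_reals all_analysis.
From mathcomp Require Import lra ring.

Import Order.TTheory GRing.Theory Num.Theory.
Import numFieldNormedType.Exports.

Local Open Scope ring_scope.
Local Open Scope complex_scope.
Local Open Scope sesquilinear_scope.

Set Implicit Arguments.
Unset Strict Implicit.
Unset Printing Implicit Defensive.

Local Notation normc := Normc.normc.

(** * Entrywise bounds on complex matrices *)

Section EntryBound.
Variable R : realType.
Implicit Types (a b c u : R) (z : R[i]).

Lemma normc_norm z : `|z| = (normc z)%:C.
Proof. by rewrite normc_def; case: z. Qed.

Lemma normc_ge0 z : 0 <= normc z.
Proof. by rewrite -lecR -normc_norm normr_ge0. Qed.

Lemma normcC z : normc (Num.conj z) = normc z.
Proof. by apply: complexI; rewrite -!normc_norm norm_conjC. Qed.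

Lemma conjC_real a : Num.conj (a%:C : R[i]) = a%:C.
Proof. exact: conjc_real. Qed.

Lemma normc_real a : normc a%:C = `|a|.
Proof. by rewrite /= expr0n addr0 sqrtr_sqr. Qed.

Lemma normc_sum (I : finType) (F : I -> R[i]) :
  normc (\sum_i F i) <= \sum_i normc (F i).
Proof.
rewrite -lecR -normc_norm rmorph_sum /=.
under [X in _ <= X]eq_bigr do rewrite -normc_norm.
exact: ler_norm_sum.
Qed.

Lemma Re_le_normc z : `|complex.Re z| <= normc z.
Proof. by rewrite -lecR -normc_norm normc_ge_Re. Qed.

(** Stands in for the Frobenius norm until the very end: factors depending on [n] are harmless, and
    products need only the triangle inequality. *)
Definition entry_bound m n (M : 'M[R[i]]_(m, n)) b := forall i j, normc (M i j) <= b.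

Lemma entry_boundW m n (M : 'M[R[i]]_(m, n)) a b :
  a <= b -> entry_bound M a -> entry_bound M b.
Proof. by move=> ab Ma i j; apply: le_trans ab. Qed.

Lemma entry_boundD m n (M N : 'M[R[i]]_(m, n)) a b :
  entry_bound M a -> entry_bound N b -> entry_bound (M + N) (a + b).
Proof.
by move=> Ma Nb i j; rewrite mxE (le_trans (le_normcD _ _))// lerD.
Qed.

Lemma entry_boundN m n (M : 'M[R[i]]_(m, n)) a :
  entry_bound M a -> entry_bound (- M) a.
Proof. by move=> Ma i j; rewrite mxE normcN. Qed.

Lemma entry_bound_adj m n (M : 'M[R[i]]_(m, n)) a :
  entry_bound M a -> entry_bound (M^t*) a.
Proof. by move=> Ma i j; rewrite !mxE normcC. Qed.

Lemma entry_boundM m n p (M : 'M[R[i]]_(m, n)) (N : 'M[R[i]]_(n, p)) a b :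
  entry_bound M a -> entry_bound N b -> entry_bound (M *m N) (n%:R * (a * b)).
Proof.
move=> Ma Nb i j; rewrite mxE (le_trans (normc_sum _))//.
rewrite -[n in n%:R]card_ord mulr_natl -sumr_const ler_sum// => k _.
by rewrite Normc.normcM ler_pM ?normc_ge0.
Qed.

Lemma entry_bound_unitary m n (U : 'M[R[i]]_(m, n)) : U \is unitarymx -> entry_bound U 1.
Proof.
move=> /unitarymxP UU i j; have := congr1 (fun M : 'M[R[i]]_m => M i i) UU.
rewrite !mxE eqxx (bigD1 j)//= !mxE => e.
rewrite -(@ler_pXn2r _ 2)// ?nnegrE ?normc_ge0// expr1n -lecR rmorphXn /=.
rewrite -normc_norm normCK -[leRHS]e lerDl sumr_ge0// => k _.
by rewrite !mxE mul_conjC_ge0.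
Qed.

(** With [N = U - 1] the difference is [N C U^* + C N^*], and the entries of [U] have modulus at
    most 1. *)
Lemma entry_bound_conj n (U C : 'M[R[i]]_n) u c : U \is unitarymx ->
  entry_bound (U - 1%:M) u -> entry_bound C c ->
  entry_bound (U *m C *m U^t* - C) ((n%:R * n%:R + n%:R) * (u * c)).
Proof.
move=> UU Uu Cc.
have -> : U *m C *m U^t* - C = (U - 1%:M) *m C *m U^t* + C *m (U - 1%:M)^t*.
  rewrite linearB /= map_mxB trmx1 map_mx1 mulmxBr mulmx1 !mulmxBl mul1mx.
  by rewrite addrA subrK.
have := entry_boundD (entry_boundM (entry_boundM Uu Cc)
  (entry_bound_adj (entry_bound_unitary UU))) (entry_boundM Cc (entry_bound_adj Uu)).
by apply: entry_boundW; lra.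
Qed.

Lemma entry_bound_comp n (U V : 'M[R[i]]_n) u v : V \is unitarymx ->
  entry_bound (U - 1%:M) u -> entry_bound (V - 1%:M) v ->
  entry_bound (U *m V - 1%:M) (n%:R * u + v).
Proof.
move=> VV Uu Vv.
have -> : U *m V - 1%:M = (U - 1%:M) *m V + (V - 1%:M).
  by rewrite mulmxBl mul1mx addrA subrK.
have := entry_boundD (entry_boundM Uu (entry_bound_unitary VV)) Vv.
by apply: entry_boundW; rewrite mulr1.
Qed.

Lemma hermsymmxP n (M : 'M[R[i]]_n) : reflect (M^t* = M) (M \is hermsymmx).
Proof.
by rewrite is_hermitianmxE expr0 scale1r eq_sym; apply: eqP.
Qed.

Lemma adjM m n p (M : 'M[R[i]]_(m, n)) (N : 'M[R[i]]_(n, p)) :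
  (M *m N)^t* = N^t* *m M^t*.
Proof. by rewrite trmx_mul map_mxM. Qed.

Lemma adjD m n (M N : 'M[R[i]]_(m, n)) : (M + N)^t* = M^t* + N^t*.
Proof. by apply/matrixP=> i j; rewrite !mxE rmorphD. Qed.

Lemma adjB m n (M N : 'M[R[i]]_(m, n)) : (M - N)^t* = M^t* - N^t*.
Proof. by apply/matrixP=> i j; rewrite !mxE rmorphB. Qed.

Lemma adj1 n : (1%:M : 'M[R[i]]_n)^t* = 1%:M.
Proof. by rewrite trmx1 map_mx1. Qed.

End EntryBound.

(** * Rotations in the plane of two orthonormal vectors *)

Section Rotation.
Variable R : realType.
Implicit Types (c s t x y z : R).

(** The rows of [W] are orthonormal; the matrix acts as [G] on their span and as the identity on the
    orthogonal complement. With [N = G - 1], unitarity reduces to [N^* + N + N N^* = 0]. *)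
Lemma frame_unitary m n (W : 'M[R[i]]_(m, n)) (G : 'M[R[i]]_m) :
  W \is unitarymx -> G \is unitarymx ->
  1%:M + W^t* *m (G - 1%:M) *m W \is unitarymx.
Proof.
move=> /unitarymxP WW /unitarymxP GG; apply/unitarymxP.
have NN : (G - 1%:M)^t* + (G - 1%:M + (G - 1%:M) *m (G - 1%:M)^t*) = 0.
  rewrite adjB adj1 mulmxBl !mulmxBr !mulmx1 mul1mx GG.
  by apply/matrixP=> i j; rewrite !mxE; ring.
move: (G - 1%:M) NN => N NN.
rewrite adjD adj1 !adjM trmxCK mulmxDl !mulmxDr !mul1mx mulmx1.
have -> : W^t* *m N *m W *m (W^t* *m (N^t* *m W)) = W^t* *m (N *m N^t*) *m W.
  by rewrite !mulmxA -[_ *m W *m _]mulmxA WW mulmx1.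
rewrite mulmxA -addrA -!mulmxDl -!mulmxDr NN mulmx0 mul0mx addr0 //.
Qed.

Lemma frame_mulr m n (W : 'M[R[i]]_(m, n)) (G : 'M[R[i]]_m) :
  W \is unitarymx ->
  W *m (1%:M + W^t* *m (G - 1%:M) *m W) = G *m W.
Proof.
move=> /unitarymxP WW.
by rewrite mulmxDr mulmx1 !mulmxA WW mul1mx mulmxBl mul1mx addrCA subrr addr0.
Qed.

(* [Pi] is the part of [P] orthogonal to the frame [W]; it is fixed by the
   frame rotation on both sides. *)
Lemma frame_trace m n (W : 'M[R[i]]_(m, n)) (G D : 'M[R[i]]_m) (P C : 'M[R[i]]_n) :
  W \is unitarymx -> W *m P = D *m W -> P *m W^t* = W^t* *m D ->
  let U := 1%:M + W^t* *m (G - 1%:M) *m W in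
  \tr (P *m (U *m C *m U^t*)) = \tr (P *m C)
    + \tr (D *m (G *m (W *m C *m W^t*) *m G^t* - W *m C *m W^t*)).
Proof.
move=> WU WP PW U; have /unitarymxP WW := WU.
pose Pi := P - W^t* *m D *m W.
have PiW : Pi *m W^t* = 0 by rewrite mulmxBl -!mulmxA WW mulmx1 PW subrr.
have WPi : W *m Pi = 0 by rewrite mulmxBr !mulmxA WW mul1mx WP subrr.
have PiU : Pi *m U = Pi by rewrite mulmxDr mulmx1 !mulmxA PiW !mul0mx addr0.
have UPi : U^t* *m Pi = Pi.
  rewrite /U; move: (G - 1%:M) => N.
  rewrite adjD adj1 !adjM trmxCK mulmxDl mul1mx -!mulmxA WPi.
  by rewrite !mulmx0 addr0.
have UW := frame_mulr G WU; rewrite -/U in UW.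
have -> : P = Pi + W^t* *m D *m W by rewrite subrK.
move: (Pi) (U) PiU UPi UW => {WP PW PiW WPi U P}Pi U PiU UPi UW.
rewrite !mulmxDl !mxtraceD -addrA; congr (_ + _).
  by rewrite !mulmxA PiU mxtrace_mulC !mulmxA UPi.
rewrite [D *m (_ - _)]mulmxBr raddfB /= addrC.
have -> : \tr (W^t* *m D *m W *m C) = \tr (D *m (W *m C *m W^t*)).
  by rewrite -!mulmxA mxtrace_mulC !mulmxA.
rewrite subrK -!mulmxA mxtrace_mulC !mulmxA -[D *m W *m U]mulmxA UW.
have UW' : U^t* *m W^t* = W^t* *m G^t* by rewrite -!adjM UW.
by rewrite -[_ *m U^t* *m W^t*]mulmxA UW' !mulmxA.
Qed.


Lemma sum_ord2 (V : nmodType) (F : 'I_2 -> V) : \sum_i F i = F 0 + F 1.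
Proof.
by rewrite !big_ord_recl big_ord0 addr0; congr (F _ + F _); apply: val_inj.
Qed.

Lemma ord2P (i : 'I_2) : i = 0 \/ i = 1.
Proof. by case: i => [[|[|]]] //= ?; [left|right]; apply: val_inj. Qed.

Definition rot2 c s : 'M[R[i]]_2 := \matrix_(i, j)
  if i == j then c%:C else if i == 0 then s%:C else (- s)%:C.

Lemma adj_rot2 c s : (rot2 c s)^t* = rot2 c (- s).
Proof.
apply/matrixP=> i j; rewrite !mxE.
by case: i => [[|[|]]] //= ?; case: j => [[|[|]]] //= ?; rewrite conjC_real ?opprK.
Qed.

Lemma rot2_unitary c s : c ^+ 2 + s ^+ 2 = 1 -> rot2 c s \is unitarymx.
Proof.
move=> cs; apply/unitarymxP; rewrite adj_rot2; apply/matrixP=> i j.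
rewrite !mxE !big_ord_recl big_ord0 !mxE.
case: i => [[|[|]]] //= ?; case: j => [[|[|]]] //= ?;
  rewrite -?rmorphM ?addr0 -?rmorphD /=.
- by rewrite opprK -!expr2 cs.
- by rewrite mulrC mulNr addNr.
- by rewrite opprK mulNr mulrC addNr.
- by rewrite mulNr mulrN opprK addrC -!expr2 cs.
Qed.

(** For weights [d1 = 1] and [d2 = 0] this is the mass gained by the first diagonal entry; the
    second one loses the same amount. *)
Lemma rot2_trace (d1 d2 : R) c s x y r (H : 'M[R[i]]_2) :
  H 0 0 = x%:C -> H 1 1 = y%:C -> H 0 1 = r%:C -> H 1 0 = r%:C ->
  c ^+ 2 + s ^+ 2 = 1 ->
  \tr (diag_mx (\row_(i < 2) if i == 0 then d1%:C else d2%:C) *m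
      (rot2 c s *m H *m (rot2 c s)^t* - H)) =
  ((d1 - d2) * (s ^+ 2 * (y - x) + 2 * s * c * r))%:C.
Proof.
move=> H00 H11 H01 H10 cs; rewrite adj_rot2 mul_diag_mx /mxtrace.
do ![rewrite sum_ord2|rewrite mxE /=].
rewrite H00 H11 H01 H10; apply/eqP; rewrite eq_complex /=.
apply/andP; split; apply/eqP; last by ring.
have c2 : c ^+ 2 = 1 - s ^+ 2 by rewrite -cs addrK.
by ring: c2.
Qed.

(** Intermediate value theorem in the sine [s]; as [Num.sqrt] is total and continuous, the function
    is continuous on the whole line. *)
Lemma rotation_angle g r t s0 : 0 <= t -> 0 <= s0 <= 1 ->
  t <= s0 ^+ 2 * g + 2 * s0 * Num.sqrt (1 - s0 ^+ 2) * r ->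
  exists2 s, 0 <= s <= s0 & s ^+ 2 * g + 2 * s * Num.sqrt (1 - s ^+ 2) * r = t.
Proof.
move=> t0 /andP[s00 s01] ts0.
pose f s := s ^+ 2 * g + 2 * s * Num.sqrt (1 - s ^+ 2) * r.
have fc : continuous f.
  move=> s; apply: cvgD; first by apply: cvgMl; exact: exprn_continuous.
  apply: cvgMl; apply: cvgM; first by apply: cvgMr; exact: cvg_id.
  apply: (@continuous_comp _ _ _ (fun s => 1 - s ^+ 2) Num.sqrt).
    by apply: cvgB; [exact: cvg_cst|exact: exprn_continuous].
  exact: sqrt_continuous.
have [|s] := @IVT R f 0 s0 t s00 (continuous_subspaceT fc).
  rewrite {1 3}/f expr0n /= !mulr0 !mul0r addr0.
  by rewrite ge_min t0 le_max ts0 orbT.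
by rewrite in_itv /= => ss fs; exists s.
Qed.

(** Supplies the unit factor that makes an off-diagonal entry real and nonnegative, so that the
    cross term of a rotation has a favourable sign. *)
Lemma phase (z : R[i]) :
  exists2 p : R[i], p * z = (normc z)%:C & Num.conj p * p = 1.
Proof.
have [->|z0] := eqVneq z 0.
  by exists 1; rewrite ?Normc.normc0 ?mulr0 // rmorph1 mulr1.
have n0 : `|z| != 0 by rewrite normr_eq0.
exists (Num.conj z / `|z|).
  by rewrite -normc_norm mulrAC -normCKC expr2 mulfK.
have -> : Num.conj (Num.conj z / `|z|) = z / `|z|.
  by rewrite rmorphM; congr (_ * _); [exact: conjCK|apply: CrealP; rewrite rpredV normr_real].
rewrite mulrACA -normCK.
by rewrite -invfM -expr2 divff// expf_eq0.
Qed.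


(** The Rayleigh quotient when the row vector [v] has norm 1; for hermitian [C] the real part only
    changes the type. *)
Definition rayleigh n (C : 'M[R[i]]_n) (v : 'rV[R[i]]_n) : R :=
  complex.Re ((v *m C *m v^t*) 0 0).

Lemma rayleighE n (C : 'M[R[i]]_n) (v : 'rV[R[i]]_n) : C^t* = C ->
  (v *m C *m v^t*) 0 0 = (rayleigh C v)%:C.
Proof.
move=> Ch; rewrite RRe_real// CrealE.
have /(congr1 (fun M : 'M[R[i]]_1 => M 0 0)) : (v *m C *m v^t*)^t* = v *m C *m v^t*.
  by rewrite !adjM trmxCK Ch mulmxA.
by rewrite !mxE => /eqP.
Qed.

(** The boolean treats support inside [b] and support off [b] alike, and counts as 1 or 0 in the
    mass balance over [b]. *)
Definition supported n (v : 'rV[R[i]]_n) (b : {set 'I_n}) (d : bool) :=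
  forall k, v 0 k != 0 -> (k \in b) = d.

(** The mass [t] goes from [w] to [v]. By the last hypothesis the rotation of sine [s0] moves at
    least [t], so one of sine at most [s0] moves exactly [t]. The same [U] serves all sets [b]:
    singletons when [v] and [w] are coordinate vectors, components in general. *)
Lemma plane_rotation n (C : 'M[R[i]]_n) (v w : 'rV[R[i]]_n) t s0 :
  C^t* = C ->
  v *m v^t* = 1%:M -> w *m w^t* = 1%:M -> v *m w^t* = 0 ->
  0 <= t -> 0 <= s0 <= 1 ->
  t <= s0 ^+ 2 * (rayleigh C w - rayleigh C v) +
       2 * s0 * Num.sqrt (1 - s0 ^+ 2) * normc ((v *m C *m w^t*) 0 0) ->
  exists U, [/\ U \is unitarymx, entry_bound (U - 1%:M) (4 * s0) &
    forall b d1 d2, supported v b d1 -> supported w b d2 ->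
      \sum_(k in b) (U *m C *m U^t*) k k =
      \sum_(k in b) C k k + (t * (d1%:R - d2%:R))%:C].
Proof.
move=> Ch v1 w1 vw t0 s01 /(rotation_angle t0 s01)[s /andP[s0p ss0] st].
have [p pz p1] := phase ((v *m C *m w^t*) 0 0).
have s1 : s <= 1 by case/andP: s01 => _; apply: le_trans.
set c := Num.sqrt (1 - s ^+ 2) in st.
have s2 : 0 <= 1 - s ^+ 2 by rewrite subr_ge0 expr_le1.
have cs : c ^+ 2 + s ^+ 2 = 1 by rewrite sqr_sqrtr// subrK.
(* The phase put on the second row makes [H 0 1] equal to the modulus of [v C w^*]. *)
pose W : 'M[R[i]]_(2, n) := \matrix_(i, k) if i == 0 then v 0 k else Num.conj p * w 0 k.
have row0 : row 0 W = v by apply/rowP=> k; rewrite !mxE.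
have row1 : row 1 W = Num.conj p *: w by apply/rowP=> k; rewrite !mxE.
have adjZ (a : R[i]) (u : 'rV[R[i]]_n) : (a *: u)^t* = Num.conj a *: u^t*.
  by apply/matrixP=> i j; rewrite !mxE rmorphM.
have WE (M : 'M[R[i]]_n) i j : (W *m M *m W^t*) i j = (row i W *m M *m (row j W)^t*) 0 0.
  rewrite !mxE; apply: eq_bigr => k _; rewrite !mxE; congr (_ * _).
  by apply: eq_bigr => l _; rewrite !mxE.
have wv : w *m v^t* = 0.
  by rewrite -[LHS]trmxCK adjM trmxCK vw linear0 map_mx0.
have UW : W \is unitarymx.
  apply/unitarymxP/matrixP=> i j; rewrite -[W in W *m _]mulmx1 WE mulmx1.
  by case: (ord2P i) (ord2P j) => [] -> [] ->; rewrite ?row0 ?row1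
    ?adjZ -?scalemxAl -?scalemxAr ?v1 ?w1 ?vw ?wv ?scaler0 !mxE //= conjCK mulr1 p1.
pose H := W *m C *m W^t*.
have H00 : H 0 0 = (rayleigh C v)%:C by rewrite WE row0 rayleighE.
have H11 : H 1 1 = (rayleigh C w)%:C.
  rewrite WE row1 adjZ -!scalemxAl -scalemxAr !mxE conjCK mulrA p1 mul1r.
  by rewrite -rayleighE// !mxE.
have H01 : H 0 1 = (normc ((v *m C *m w^t*) 0 0))%:C.
  by rewrite WE row0 row1 adjZ -scalemxAr [LHS]mxE conjCK pz.
have H10 : H 1 0 = (normc ((v *m C *m w^t*) 0 0))%:C.
  have Hh : H^t* = H by rewrite !adjM trmxCK Ch mulmxA.
  by rewrite -[H in LHS]Hh 2!mxE H01 conjC_real.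
exists (1%:M + W^t* *m (rot2 c s - 1%:M) *m W); split.
- by apply: frame_unitary => //; apply: rot2_unitary.
(* The constant 4 arises from two products of inner dimension 2. *)
- rewrite addrAC subrr add0r.
  have Gs : entry_bound (rot2 c s - 1%:M) s.
    have c1 : `|c - 1| <= s.
      have c0 : 0 <= c by apply: sqrtr_ge0.
      have c1 : c <= 1.
        by rewrite -(@expr_le1 _ 2)// sqr_sqrtr// gerBl sqr_ge0.
      have : 1 - s <= c.
        rewrite -(@ler_pXn2r _ 2)// ?nnegrE ?subr_ge0// sqr_sqrtr//; nra.
      by rewrite ler_norml; lra.
    have e1 : normc (c%:C - 1%R) <= s.
      by rewrite -(rmorph1 (real_complex R)) -rmorphB normc_real.
    have e2 : normc (s%:C - 0) <= s by rewrite subr0 normc_real ger0_norm.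
    have e3 : normc ((- s)%:C - 0) <= s by rewrite subr0 normc_real normrN ger0_norm.
    move=> i j; case: (ord2P i) (ord2P j) => [] -> [] ->; rewrite 4!mxE.
    - exact: e1.
    - exact: e2.
    - exact: e3.
    - exact: e1.
  have W1 := entry_bound_unitary UW.
  have := entry_boundM (entry_boundM (entry_bound_adj W1) Gs) W1.
  by apply: entry_boundW; rewrite !mul1r mulr1 mulrA -natrM ler_wpM2l.
(* [P] is the coordinate projection onto [b]. Both rows of [W] are eigenvectors of [P], with
   eigenvalues 0 or 1, so [frame_trace] reduces the sum over [b] to a 2 by 2 trace. *)
- move=> b d1 d2 vb wb; pose P := diag_mx (\row_k ((k \in b)%:R : R[i])).
  have trP (M : 'M[R[i]]_n) : \sum_(k in b) M k k = \tr (P *m M).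
    rewrite mul_diag_mx /mxtrace big_mkcond; apply: eq_bigr => k _.
    by rewrite !mxE; case: (k \in b); rewrite ?mul1r ?mul0r.
  pose D : 'M[R[i]]_2 :=
    diag_mx (\row_(i < 2) if i == 0 then d1%:R%:C else d2%:R%:C).
  have WP : W *m P = D *m W.
    apply/matrixP=> i k; rewrite mul_mx_diag mul_diag_mx !mxE mulrC.
    case: ifP => _.
      have [->|/vb ->] := eqVneq (v 0 k) 0; first by rewrite !mulr0.
      by rewrite rmorph_nat.
    have [->|/wb ->] := eqVneq (w 0 k) 0; first by rewrite !mulr0.
    by rewrite rmorph_nat.
  have PW : P *m W^t* = W^t* *m D.
    have := congr1 (fun M : 'M[R[i]]_(2, n) => M^t*) WP; rewrite /= !adjM.
    have -> : P^t* = P.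
      apply/matrixP=> i j; rewrite !mxE rmorphMn eq_sym rmorph_nat.
      by have [->|] := eqVneq i j.
    suff -> : D^t* = D by [].
    by apply/matrixP=> i j; case: (ord2P i) (ord2P j) => [] -> [] ->;
      rewrite !mxE /= ?mulr0n ?mulr1n ?conjC_real ?rmorph0.
  rewrite !trP (frame_trace _ _ UW WP PW) -/H (rot2_trace _ _ H00 H11 H01 H10 cs).
  by rewrite st mulrC.
Qed.

End Rotation.

(** * Composable corrections of the diagonal *)

Section Reach.
Variables (R : realType) (n : nat) (A : 'M[R[i]]_n).
Implicit Types (b c t : R) (C U : 'M[R[i]]_n) (x : 'rV[R]_n).
Implicit Types D : R -> 'rV[R]_n -> Prop.

(* [eta] plays the role of [sqrt e]; [D b] is the set of diagonal displacements of
   size at most [b]. The cases of interest are [p = 1] (rotations across an edge)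
   and [p = 2] (rotations between components). *)
Definition reachable p D := forall M, 0 <= M -> exists c delta, [/\ 0 <= c, 0 < delta &
  forall eta C x, 0 < eta < delta -> C^t* = C -> entry_bound (C - A) (M * eta) ->
    D (M * eta ^+ p) x ->
    exists U, [/\ U \is unitarymx, entry_bound (U - 1%:M) (c * eta) &
      forall k, (U *m C *m U^t*) k k = C k k + (x 0 k)%:C]].

Definition increasing D := forall b c x, b <= c -> D b x -> D c x.

Lemma entry_bound_exists m p (N : 'M[R[i]]_(m, p)) :
  exists2 a, 0 <= a & entry_bound N a.
Proof.
exists (\sum_i \sum_j normc (N i j)).
  by apply: sumr_ge0 => i _; apply: sumr_ge0 => j _; apply: normc_ge0.
move=> i j; rewrite (bigD1 i)//= (bigD1 j)//= -addrA lerDl.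
rewrite addr_ge0// sumr_ge0// => k _; first exact: normc_ge0.
by rewrite sumr_ge0// => l _; apply: normc_ge0.
Qed.

Lemma reachable_sub p D D' :
  (forall b x, D b x -> D' b x) -> reachable p D' -> reachable p D.
Proof.
move=> DD' rD' M M0; have [c [delta [c0 d0 H]]] := rD' _ M0.
by exists c, delta; split=> // eta C x eta0 Ch CA /DD'; apply: H.
Qed.

Lemma reachable_lower D : increasing D -> reachable 1 D -> reachable 2 D.
Proof.
move=> mD rD M M0; have [c [delta [c0 d0 H]]] := rD _ M0.
exists c, (Num.min delta 1); split=> //; first by rewrite lt_min d0 ltr01.
move=> eta C x /andP[e0]; rewrite lt_min => /andP[ed e1] Ch CA Dx.
apply: (H eta C x) => //; first by rewrite e0.
apply: mD Dx; rewrite expr1 expr2 ler_wpM2l// ler_piMl//; exact: ltW.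
Qed.

Lemma reachable0 p D : (forall b x, D b x -> x = 0) -> reachable p D.
Proof.
move=> D0 M M0; exists 0, 1; split=> // eta C x _ Ch _ /D0 ->.
exists 1%:M; split=> [|i j|k].
- by apply/unitarymxP; rewrite adj1 mulmx1.
- by rewrite subrr mul0r mxE Normc.normc0.
- by rewrite adj1 mulmx1 mul1mx mxE rmorph0 addr0.
Qed.

(** [K] depends on [A] only. A matrix [O(eta)]-close to [A] thus remains so after conjugation by a
    unitary [O(eta)]-close to 1, which is what allows corrections to be chained. *)
Lemma near_conj : exists2 K, 0 <= K & forall M c eta C U, 0 <= M -> 0 <= c ->
  0 < eta < 1 -> U \is unitarymx ->
  entry_bound (U - 1%:M) (c * eta) -> entry_bound (C - A) (M * eta) ->
  entry_bound (U *m C *m U^t* - C) (K * (1 + M) * c * eta).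
Proof.
have [a a0 Aa] := entry_bound_exists A.
pose k : R := n%:R * n%:R + n%:R; have k0 : 0 <= k by rewrite addr_ge0 ?mulr_ge0.
exists (k * (1 + a)); first by rewrite mulr_ge0// addr_ge0.
move=> M c eta C U M0 c0 /andP[e0 e1] UU Uc CA.
have Ca : entry_bound C (M + a).
  rewrite -(subrK A C); apply: entry_boundD Aa; apply: entry_boundW CA.
  by rewrite ler_piMr// ltW.
apply: entry_boundW (entry_bound_conj UU Uc Ca); rewrite -/k.
have -> : k * (1 + a) * (1 + M) * c * eta = k * (c * eta * ((1 + a) * (1 + M))) by ring.
rewrite ler_wpM2l// ler_wpM2l ?mulr_ge0//; first exact: ltW.
by have := mulr_ge0 a0 M0; lra.
Qed.

(** A first unitary may miss its target by an error [y] that a second one removes. The exponents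
    differ when an [O(eta^2)] transfer leaves an [O(eta)] error. *)
Lemma reachable_step p q D D' : increasing D' ->
  (forall M, 0 <= M -> exists c delta, [/\ 0 <= c, 0 < delta &
    forall eta C x, 0 < eta < delta -> C^t* = C -> entry_bound (C - A) (M * eta) ->
      D (M * eta ^+ p) x ->
      exists U (y : 'rV[R]_n), [/\ U \is unitarymx, entry_bound (U - 1%:M) (c * eta),
        forall k, (U *m C *m U^t*) k k = C k k + (x 0 k - y 0 k)%:C &
        D' (c * eta ^+ q) y]]) ->
  reachable q D' -> reachable p D.
Proof.
move=> mD' stepD rD' M M0; have [c [delta [c0 d0 H]]] := stepD _ M0.
have [K K0 HK] := near_conj.
have L0 : 0 <= K * (1 + M) * c by rewrite !mulr_ge0// addr_ge0.
(* The second correction must tolerate the original distance to [A], the drift caused by the first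
   unitary, and an error of size governed by [c]. *)
have M'0 : 0 <= M + K * (1 + M) * c + c by rewrite !addr_ge0.
have [c' [delta' [c'0 d'0 H']]] := rD' _ M'0.
exists (n%:R * c' + c), (Num.min 1 (Num.min delta delta')); split.
- by rewrite addr_ge0// mulr_ge0.
- by rewrite !lt_min ltr01 d0.
move=> eta C x /andP[e0]; rewrite !lt_min => /and3P[e1 ed ed'] Ch CA Dx.
have [|U [y [UU Uc Ux Dy]]] := H eta C x _ Ch CA Dx; first by rewrite e0.
have [||||V [VV Vc Vx]] := H' eta (U *m C *m U^t*) y.
- by rewrite e0.
- by rewrite !adjM trmxCK Ch mulmxA.
- rewrite -(subrK C (U *m C *m U^t*)) -addrA addrC.
  apply: (@entry_boundW _ _ _ _ (M * eta + K * (1 + M) * c * eta)).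
    by rewrite -mulrDl ler_wpM2r ?lerDl// ltW.
  by apply: entry_boundD => //; apply: HK => //; rewrite e0.
- by apply: mD' Dy; rewrite ler_wpM2r ?exprn_ge0 ?lerDr ?addr_ge0// ltW.
exists (V *m U); split; first exact: mul_unitarymx.
  by rewrite mulrDl -mulrA; apply: entry_bound_comp.
move=> k; rewrite adjM.
have -> : V *m U *m C *m (U^t* *m V^t*) = V *m (U *m C *m U^t*) *m V^t*.
  by rewrite !mulmxA.
by rewrite Vx Ux -addrA -rmorphD subrK.
Qed.

Lemma reachable_add p D D' : increasing D' ->
  reachable p D -> reachable p D' ->
  reachable p (fun b x => exists x1 x2, [/\ D b x1, D' b x2 & x = x1 + x2]).
Proof.
move=> mD' rD; apply: reachable_step => // M M0.
have [c [delta [c0 d0 H]]] := rD _ M0.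
exists (c + M), delta; split=> //; first by rewrite addr_ge0.
move=> eta C x eta0 Ch CA [x1 [x2 [Dx1 Dx2 ->]]].
have e0 : 0 <= eta by case/andP: eta0 => /ltW.
have [U [UU Uc Ux]] := H _ _ _ eta0 Ch CA Dx1.
exists U, x2; split=> //; first by apply: entry_boundW Uc; rewrite ler_wpM2r ?lerDl.
  by move=> k; rewrite Ux mxE addrK.
by apply: mD' Dx2; rewrite ler_wpM2r ?exprn_ge0 ?lerDr.
Qed.

Lemma reachable_sum p (I : finType) (D : I -> R -> 'rV[R]_n -> Prop) :
  (forall i, increasing (D i)) -> (forall i, reachable p (D i)) ->
  reachable p (fun b x => exists2 f : I -> 'rV[R]_n,
    forall i, D i b (f i) & x = \sum_i f i).
Proof.
move=> mD rD.
suff H (r : seq I) : reachable p (fun b x => exists2 f : I -> 'rV[R]_n,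
    forall i, D i b (f i) & x = \sum_(i <- r) f i) by exact: H.
elim: r => [|i r IH].
  by apply: reachable0 => b x [f _ ->]; rewrite big_nil.
apply: reachable_sub (reachable_add _ (rD i) IH).
  move=> b x [f Df ->]; rewrite big_cons.
  by exists (f i), (\sum_(i <- r) f i); split=> //; exists f.
by move=> b c x bc [f Df ->]; exists f => // k; apply: mD bc (Df k).
Qed.

(** Mass flows from [j] to [i]. The relation is directed because a Rayleigh gap yields one direction
    only. *)
Definition transfer i j b x :=
  exists2 t, 0 <= t <= b & x = t *: (delta_mx 0 i - delta_mx 0 j).

Lemma increasing_transfer i j : increasing (transfer i j).
Proof.
by move=> b c x bc [t /andP[t0 tb] ->]; exists t => //; rewrite t0 (le_trans tb).
Qed.

Lemma reachable_refl p i : reachable p (transfer i i).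
Proof. by apply: reachable0 => b x [t _ ->]; rewrite subrr scaler0. Qed.

Lemma reachable_trans p i j k : reachable p (transfer i j) ->
  reachable p (transfer j k) -> reachable p (transfer i k).
Proof.
move=> ij jk; apply: reachable_sub (reachable_add _ ij jk).
- move=> b x [t tb ->].
  exists (t *: (delta_mx 0 i - delta_mx 0 j)), (t *: (delta_mx 0 j - delta_mx 0 k)).
  by split; [exists t|exists t|rewrite -scalerDr addrA subrK].
- exact: increasing_transfer.
Qed.

(** Each index exchanges mass with its representative [r k], in the direction given by the sign of
    the coefficient. *)
Lemma reachable_routed p (r : 'I_n -> 'I_n) :
  (forall k, reachable p (transfer k (r k)) /\ reachable p (transfer (r k) k)) ->
  reachable p (fun b x => (forall k, `|x 0 k| <= b) /\
    x = \sum_k x 0 k *: (delta_mx 0 k - delta_mx 0 (r k))).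
Proof.
move=> kr; pose D k b x := exists2 t, `|t| <= b & x = t *: (delta_mx 0 k - delta_mx 0 (r k)).
have mD k : increasing (D k).
  by move=> b c x bc [t tb ->]; exists t => //; apply: le_trans bc.
have rD k : reachable p (D k).
  have [k1 k2] := kr k.
  apply: reachable_sub (reachable_add _ k1 k2).
  - move=> b x [t tb ->]; have b0 : 0 <= b := le_trans (normr_ge0 t) tb.
    have [t0|t0] := leP 0 t.
      exists (t *: (delta_mx 0 k - delta_mx 0 (r k))), 0; split; last by rewrite addr0.
        by exists t => //; rewrite t0 -(ger0_norm t0).
      by exists 0; rewrite ?lexx // scale0r.
    exists 0, (t *: (delta_mx 0 k - delta_mx 0 (r k))); split; last by rewrite add0r.
      by exists 0; rewrite ?lexx // scale0r.
    by exists (- t); rewrite ?scaleNr -?scalerN ?opprB// oppr_ge0 (ltW t0) -(ltr0_norm t0).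
  - exact: increasing_transfer.
apply: reachable_sub (reachable_sum mD rD) => b x [xb xE].
exists (fun k => x 0 k *: (delta_mx 0 k - delta_mx 0 (r k))) => // k.
by exists (x 0 k).
Qed.

End Reach.

(** * Transfers along an edge and between components *)

Section Transfers.
Variables (R : realType) (n : nat) (A : 'M[R[i]]_n).
Hypothesis Ah : A^t* = A.
Implicit Types (a b t : R) (C U : 'M[R[i]]_n) (v w : 'rV[R[i]]_n).

Lemma ReB (y z : R[i]) : complex.Re (y - z) = complex.Re y - complex.Re z.
Proof. by case: y z => [? ?] []. Qed.

Lemma small_scale (K b : R) : 0 <= K -> 0 < b ->
  exists2 delta, 0 < delta & forall eta : R, 0 < eta < delta -> K * eta <= b.
Proof.
move=> K0 b0; have K1 : 0 < K + 1 by rewrite ltr_wpDl.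
exists (b / (K + 1)); first by rewrite divr_gt0.
move=> eta /andP[e0]; rewrite ltr_pdivlMr// => /ltW; apply: le_trans.
by rewrite mulrC mulrDr lerDl mulr1 ltW.
Qed.

Lemma delta_form C i j : delta_mx 0 i *m C *m (delta_mx 0 j : 'rV[R[i]]_n)^t* = (C i j)%:M.
Proof.
rewrite trmx_delta map_delta_mx -rowE -colE.
by apply/matrixP=> k l; rewrite !mxE !ord1 eqxx mulr1n.
Qed.

Lemma delta_orthonormal i j :
  delta_mx 0 i *m (delta_mx 0 j : 'rV[R[i]]_n)^t* = ((i == j)%:R)%:M.
Proof. by have := delta_form 1%:M i j; rewrite mulmx1 mxE. Qed.

(** The cross term is of first order in the angle and, as [C i j] stays away from 0, dominates the
    second-order term; hence mass [O(eta)] costs an angle [O(eta)]. *)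
Lemma reachable_edge i j : i != j -> A i j != 0 -> reachable A 1 (transfer i j).
Proof.
move=> ij Aij M M0; have [a a0 Aa] := entry_bound_exists A.
(* [kap] will bound [normc (C i j)] from below, and [Y] the difference of two diagonal entries of
   [C] from above. *)
pose kap := normc (A i j) / 2; pose Y := 2 * (a + M).
have kap0 : 0 < kap.
  rewrite divr_gt0// lt_def normc_ge0 andbT; apply: contra Aij => /eqP.
  by move=> /Normc.eq0_normc ->.
have Y0 : 0 <= Y by rewrite mulr_ge0// addr_ge0.
have Mk : 0 <= M / kap by rewrite divr_ge0// ltW.
have [d1 d10 H1] := small_scale M0 kap0.
have [d2 d20 H2] := small_scale Mk (divr_gt0 ltr01 (ltr0Sn R 1)).
have [d3 d30 H3] := small_scale (mulr_ge0 Mk Y0) (divr_gt0 kap0 (ltr0Sn R 1)).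
exists (4 * (M / kap)), (Num.min 1 (Num.min d1 (Num.min d2 d3))).
split; first by rewrite mulr_ge0.
  by rewrite !lt_min ltr01 d10 d20.
move=> eta C x /andP[e0]; rewrite !lt_min => /and4P[e1 ed1 ed2 ed3] Ch CA.
rewrite expr1 => -[t /andP[t0 tM] ->].
have {ed1} Hk : M * eta <= kap by apply: H1; rewrite e0.
have {ed2} Hh : M / kap * eta <= 1 / 2 by apply: H2; rewrite e0.
have {ed3} HY : M / kap * Y * eta <= kap / 2 by apply: H3; rewrite e0.
pose s0 := t / kap.
have s00 : 0 <= s0 by rewrite divr_ge0// ltW.
have s0M : s0 <= M / kap * eta by rewrite mulrAC ler_wpM2r// invr_ge0 ltW.
have s0h : s0 <= 1 / 2 := le_trans s0M Hh.
have Cb : entry_bound C (a + M).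
  rewrite -(subrK A C) addrC; apply: entry_boundD => //; apply: entry_boundW CA.
  by rewrite ler_piMr// ltW.
have form k l := congr1 (fun N : 'M[R[i]]_1 => N 0 0) (delta_form C k l).
have ray k : rayleigh C (delta_mx 0 k) = complex.Re (C k k).
  by rewrite /rayleigh form mxE eqxx mulr1n.
have Cij : kap <= normc (C i j).
  have := le_normcD (A i j - C i j) (C i j); rewrite subrK.
  have := CA i j; rewrite -normcN !mxE opprB => h1 h2.
  have : normc (A i j) <= kap + normc (C i j).
    by apply: le_trans h2 _; rewrite lerD2r (le_trans h1).
  by rewrite /kap; lra.
have [||||||U [UU Uc UC]] := @plane_rotation R n C (delta_mx 0 i) (delta_mx 0 j) t s0 Ch.
- by rewrite delta_orthonormal eqxx.
- by rewrite delta_orthonormal eqxx.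
- by rewrite delta_orthonormal (negPf ij) raddf0.
- by [].
- by rewrite s00 (le_trans s0h)//; lra.
(* Since [s0 = t / kap], the cross term is at least [3/2 t] and the square term at least [- t/2]. *)
- rewrite !ray form mxE eqxx mulr1n.
  have sq : 3 / 4 <= Num.sqrt (1 - s0 ^+ 2).
    rewrite -(@ler_pXn2r _ 2)// ?nnegrE ?sqrtr_ge0//; try by lra.
    by rewrite sqr_sqrtr; nra.
  have yx : - Y <= complex.Re (C j j) - complex.Re (C i i).
    have := le_trans (Re_le_normc _) (Cb i i); have := le_trans (Re_le_normc _) (Cb j j).
    by rewrite !ler_norml /Y => /andP[? ?] /andP[? ?]; lra.
  have sY : s0 * Y <= kap / 2.
    by apply: le_trans HY; rewrite [leRHS]mulrAC ler_wpM2r.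
  have tE : t = s0 * kap by rewrite divfK// gt_eqF.
  have p1 : 3 / 4 * kap <= Num.sqrt (1 - s0 ^+ 2) * normc (C i j).
    by rewrite ler_pM// ltW.
  have -> : 2 * s0 * Num.sqrt (1 - s0 ^+ 2) * normc (C i j) =
            2 * s0 * (Num.sqrt (1 - s0 ^+ 2) * normc (C i j)) by rewrite !mulrA.
  have p2 := ler_wpM2l (mulr_ge0 (ler0n R 2) s00) p1.
  have p3 := ler_wpM2l (sqr_ge0 s0) yx.
  have p4 := ler_wpM2l s00 sY.
  by rewrite tE; lra.
exists U; split=> //.
  by apply: entry_boundW Uc; rewrite -mulrA ler_wpM2l.
move=> k; have := UC [set k]%SET (i == k) (j == k); rewrite !big_set1 => ->.
- by congr (_ + (_)%:C); rewrite !mxE eqxx /= (eq_sym i) (eq_sym j).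
- by move=> l; rewrite !mxE inE /=; case: (eqVneq l i) => [->|]; rewrite ?eqxx.
- by move=> l; rewrite !mxE inE /=; case: (eqVneq l j) => [->|]; rewrite ?eqxx.
Qed.

Lemma rayleigh_close C v b : v *m v^t* = 1%:M -> entry_bound (C - A) b ->
  `|rayleigh C v - rayleigh A v| <= n%:R * n%:R * b.
Proof.
move=> v1 CA; have /(_ 0 0) : entry_bound (v *m (C - A) *m v^t*) (n%:R * n%:R * b).
  have vu : entry_bound v 1 by apply/entry_bound_unitary/unitarymxP.
  have := entry_boundM (entry_boundM vu CA) (entry_bound_adj vu).
  by rewrite mul1r mulr1 mulrA.
apply: le_trans.
rewrite mulmxBr mulmxBl [X in normc X]mxE [X in normc (_ + X)]mxE.
by rewrite -ReB Re_le_normc.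
Qed.

Lemma hermitian_diag C k : C^t* = C -> (complex.Re (C k k))%:C = C k k.
Proof. move=> Ch; rewrite RRe_real// CrealE.
by have /eqP := congr1 (fun M : 'M[R[i]]_n => M k k) Ch; rewrite !mxE. Qed.

Lemma sum_delta (b : {set 'I_n}) i :
  \sum_(k in b) (delta_mx 0 i : 'rV[R]_n) 0 k = (i \in b)%:R.
Proof.
under eq_bigr do rewrite mxE eqxx /=.
have [ib|ib] := boolP (i \in b).
  by rewrite (bigD1 i)//= eqxx big1 ?addr0// => k /andP[_ /negPf ->].
by rewrite big1// => k kb; case: eqP kb ib => // -> ->.
Qed.

(** The terms [delta_mx 0 (r k)] cancel because the weights on each fibre of [r] sum to zero. *)
Lemma routed_decomp (r : 'I_n -> 'I_n) (y : 'rV[R]_n) :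
  (forall l, \sum_(k | r k == l) y 0 k = 0) ->
  y = \sum_k y 0 k *: (delta_mx 0 k - delta_mx 0 (r k)).
Proof.
move=> yr; under eq_bigr do rewrite scalerBr.
rewrite sumrB -row_sum_delta.
suff -> : \sum_k y 0 k *: delta_mx 0 (r k) = 0 :> 'rV[R]_n by rewrite subr0.
apply/rowP=> l; rewrite summxE mxE -[RHS](yr l) [RHS]big_mkcond.
apply: eq_bigr => k _; rewrite !mxE eqxx /= eq_sym.
by case: (r k == l); rewrite ?mulr1 ?mulr0.
Qed.

(** The gain is [s^2] times the Rayleigh gap, so mass [O(eta^2)] needs an angle [O(eta)]. The
    rotation gives every fibre of [r] its exact total; the [O(eta)] error left inside the fibres is
    routed away with exponent 1. *)
Lemma reachable_cross (r : 'I_n -> 'I_n) i j v w :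
  (forall k, reachable A 1 (transfer k (r k)) /\ reachable A 1 (transfer (r k) k)) ->
  (forall k, v 0 k != 0 -> r k = r i) -> (forall k, w 0 k != 0 -> r k = r j) ->
  r i != r j -> v *m v^t* = 1%:M -> w *m w^t* = 1%:M ->
  rayleigh A v < rayleigh A w -> reachable A 2 (transfer i j).
Proof.
(* [g] is half the gap at [A]; for small [eta] the gap at [C] is still at least [g]. *)
move=> kr vi wj rij v1 w1 vw; pose g := (rayleigh A w - rayleigh A v) / 2.
have g0 : 0 < g by rewrite divr_gt0// subr_gt0.
have vw0 : v *m w^t* = 0.
  apply/matrixP=> k l; rewrite !ord1 !mxE big1// => m _; rewrite !mxE.
  have [->|vm] := eqVneq (v 0 m) 0; first by rewrite mul0r.
  have [->|wm] := eqVneq (w 0 m) 0; first by rewrite rmorph0 mulr0.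
  by have := vi _ vm; rewrite (wj _ wm) => e; rewrite e eqxx in rij.
apply: reachable_step (reachable_routed kr).
  by move=> b c x bc [xb xE]; split=> // k; apply: le_trans bc.
move=> M M0; have [K K0 HK] := near_conj A.
have Mg : 0 <= M / g by rewrite divr_ge0// ltW.
pose c1 := 4 * Num.sqrt (M / g).
have c10 : 0 <= c1 by rewrite mulr_ge0// sqrtr_ge0.
pose c2 := M + K * (1 + M) * c1.
have L0 : 0 <= K * (1 + M) * c1 by rewrite !mulr_ge0// addr_ge0.
have [d1 d10 H1] := small_scale (sqrtr_ge0 (M / g)) ltr01.
have [d2 d20 H2] := small_scale (mulr_ge0 (mulr_ge0 (ler0n R n) (ler0n R n)) M0)
   (divr_gt0 g0 (ltr0Sn R 1)).
exists (c1 + c2), (Num.min 1 (Num.min d1 d2)); split.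
- by rewrite !addr_ge0.
- by rewrite !lt_min ltr01 d10.
move=> eta C ? /andP[e0]; rewrite !lt_min => /and3P[e1 ed1 ed2] Ch CA.
move=> [t /andP[t0 tM] ->].
have {ed1} Hs : Num.sqrt (M / g) * eta <= 1 by apply: H1; rewrite e0.
have {ed2} Hg : n%:R * n%:R * M * eta <= g / 2 by apply: H2; rewrite e0.
(* Chosen so that [s0 ^+ 2 * g = t]; the nonnegative cross term only helps. *)
pose s0 := Num.sqrt (t / g).
have s0M : s0 <= Num.sqrt (M / g) * eta.
  rewrite -[X in _ * X](ger0_norm (ltW e0)) -sqrtr_sqr -sqrtrM//.
  by rewrite ler_wsqrtr// mulrAC ler_wpM2r// invr_ge0 ltW.
have [|||U [UU Uc UC]] := @plane_rotation R n C v w t s0 Ch v1 w1 vw0.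
- by [].
- by rewrite sqrtr_ge0 (le_trans s0M).
- rewrite -[leLHS]addr0 lerD//; last first.
    by rewrite !mulr_ge0 ?sqrtr_ge0// normc_ge0.
  have tg : 0 <= t / g by rewrite divr_ge0// ltW.
  rewrite sqr_sqrtr// -[leLHS](divfK (lt0r_neq0 g0)) ler_wpM2l//.
  have := rayleigh_close v1 CA; have := rayleigh_close w1 CA.
  rewrite mulrA !ler_norml => /andP[? ?] /andP[? ?].
  by rewrite /g in Hg *; lra.
have Uc1 : entry_bound (U - 1%:M) (c1 * eta).
  by apply: entry_boundW Uc; rewrite -mulrA ler_wpM2l.
set C' := U *m C *m U^t* in UC *.
have C'h : C'^t* = C' by rewrite !adjM trmxCK Ch mulmxA.
(* [x] is the displacement asked for and [z] the one obtained; [x - z] is left to the routing. *)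
pose x : 'rV[R]_n := t *: (delta_mx 0 i - delta_mx 0 j).
pose z : 'rV[R]_n := \row_k complex.Re (C' k k - C k k).
have zE k : z 0 k = complex.Re (C' k k - C k k) by rewrite [LHS]mxE.
have xzE k : (x - z) 0 k = x 0 k - z 0 k by rewrite mxE [X in _ + X]mxE.
have C'z k : C' k k = C k k + (z 0 k)%:C.
  by rewrite zE ReB rmorphB /= !hermitian_diag// addrC subrK.
exists U, (x - z); split=> //.
- by apply: entry_boundW Uc1; rewrite ler_wpM2r ?lerDl ?addr_ge0// ltW.
- by move=> k; rewrite -/x C'z; congr (_ + _%:C); rewrite xzE opprB addrC subrK.
split=> [k|].
  rewrite expr1 xzE (le_trans (ler_normB _ _))//.
  have zk : `|z 0 k| <= K * (1 + M) * c1 * eta.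
    rewrite zE (le_trans (Re_le_normc _))//.
    have e01 : 0 < eta < 1 by rewrite e0.
    by have /(_ k k) := HK M c1 eta C U M0 c10 e01 UU Uc1 CA;
      rewrite [X in normc X]mxE [X in normc (_ + X)]mxE.
  have xk : `|x 0 k| <= M * eta.
    rewrite !mxE eqxx /= normrM ger0_norm// (le_trans _ (_ : t <= _))//.
      rewrite ler_piMr//; case: (k == i); case: (k == j);
      by rewrite ?subrr ?subr0 ?sub0r ?normrN ?normr0 ?normr1.
    by apply: le_trans tM _; rewrite expr2 ler_wpM2l// ler_piMl// ltW.
  apply: le_trans (lerD xk zk) _; rewrite -mulrDl ler_wpM2r ?lerDr//; exact: ltW.
(* The balance over [b] a fibre of [r] shows that [x] and [z] have the same sum there. *)
apply: routed_decomp => l.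
have := UC [set k | r k == l]%SET (r i == l) (r j == l).
under eq_bigr do rewrite C'z.
rewrite big_split /= => /(_ _ _)/addrI zl.
rewrite (eq_bigl (fun k => k \in [set k | r k == l]%SET)); last by move=> k; rewrite inE.
rewrite (eq_bigr (fun k => t * (delta_mx 0 i : 'rV[R]_n) 0 k
   - t * (delta_mx 0 j : 'rV[R]_n) 0 k - z 0 k)); last first.
  move=> k _; rewrite xzE -mulrBr [x 0 k]mxE; congr (_ * _ - _).
  by rewrite mxE [X in _ + X]mxE.
rewrite !sumrB -!mulr_sumr !sum_delta !inE -mulrBr.
apply/eqP; rewrite subr_eq0 eq_sym; apply/eqP/complexI.
rewrite rmorph_sum zl // => k.
  by move/vi=> kl; rewrite inE kl.
by move/wj=> kl; rewrite inE kl.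
Qed.

End Transfers.

(** * Prefix sums, truncated sums and majorization *)

Section Majorization.
Variable R : realType.

Lemma sum_shift (f : nat -> R) m k :
  \sum_(i < k) f i - m *+ k = \sum_(i < k) (f i - m).
Proof. by rewrite sumrB sumr_const card_ord. Qed.

Lemma sum_min_le_prefix (s : seq R) k m : (k <= size s)%N ->
  \sum_(x <- s) Num.min (x - m) 0 <= \sum_(i < k) s`_i - m *+ k.
Proof.
move=> ks; rewrite (big_nth 0) (big_cat_nat_idem _ (n := k))//=; try exact: addr0.
rewrite big_mkord -[leRHS]addr0 (sum_shift (fun i => s`_i) m k) lerD//.
  by apply: ler_sum => i _; rewrite ge_min lexx.
by apply: sumr_le0 => i _; rewrite ge_min lexx orbT.
Qed.

(** The threshold is the entry of index [k]: by sortedness the first [k.+1] entries do not exceed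
    it, so truncation leaves them exact, and the later ones contribute 0. *)
Lemma prefix_le_sum_min (s : seq R) k : sorted <=%R s -> (k < size s)%N ->
  \sum_(i < k.+1) s`_i - s`_k *+ k.+1 <= \sum_(x <- s) Num.min (x - s`_k) 0.
Proof.
move=> ss ks; rewrite [leRHS](big_nth 0) (big_cat_nat_idem _ (n := k.+1))//=; try exact: addr0.
have mono i j : (i <= j)%N -> (j < size s)%N -> s`_i <= s`_j.
  move=> ij js; apply: (sorted_leq_nth le_trans lexx 0 ss) => //; rewrite inE //.
  exact: leq_ltn_trans js.
rewrite big_mkord -[leLHS]addr0 (sum_shift (fun i => s`_i) s`_k k.+1) lerD//.
  apply: ler_sum => i _; rewrite le_min lexx /= subr_le0 mono// -ltnS; exact: ltn_ord.
rewrite big_nat_cond sumr_ge0// => i /andP[/andP[ki ks'] _].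
by rewrite le_min lexx andbT subr_ge0 mono// ltnW.
Qed.

Lemma prefix_le_subset n (d : n.-tuple R) (a : 'I_n -> R) (Y : {set 'I_n}) :
  sorted <=%R d -> perm_eq d [seq a i | i <- enum 'I_n] ->
  \sum_(i < #|Y|) d`_i <= \sum_(i in Y) a i.
Proof.
move=> ds da; case: (posnP #|Y|) => [Y0|].
  by rewrite Y0 big_ord0 (cards0_eq Y0) big_set0.
case E : #|Y| => [//|k] _.
have kn : (k < size d)%N by rewrite size_tuple -[n in (_ < n)%N]card_ord -E max_card.
have := prefix_le_sum_min ds kn; rewrite (perm_big _ da) big_map big_enum /=.
move=> /le_trans /(_ (_ : _ <= \sum_(i in Y) (a i - d`_k))) h.
rewrite -(lerD2r (- (d`_k *+ k.+1))); apply: le_trans (h _) _; last first.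
  by rewrite sumrB sumr_const E.
rewrite (bigID (mem Y))/= -[leRHS]addr0 lerD//.
  by apply: ler_sum => i _; rewrite ge_min lexx.
by apply: sumr_le0 => i _; rewrite ge_min lexx orbT.
Qed.

(* The prefix sums of [lam] and [d] are compared with truncated sums
   [\sum_x min (x - theta) 0], which do not depend on the order of the entries. *)
Lemma strict_majorization_gap n (lam d : n.-tuple R) (l a : 'I_n -> R)
    (Y : {set 'I_n}) m :
  strict_majorization lam d -> sorted <=%R d ->
  perm_eq lam [seq l i | i <- enum 'I_n] ->
  perm_eq d [seq a i | i <- enum 'I_n] ->
  (0 < #|Y| < n)%N ->
  \sum_i Num.min (l i - m) 0 < \sum_(i in Y) (a i - m).
Proof.
move=> [maj _] ds lp da /andP[Y0 Yn].
have -> : \sum_i Num.min (l i - m) 0 = \sum_(x <- lam) Num.min (x - m) 0.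
  by rewrite (perm_big _ lp) big_map big_enum.
rewrite sumrB sumr_const.
have Ylam : (#|Y| <= size lam)%N by rewrite size_tuple ltnW.
apply: le_lt_trans (sum_min_le_prefix m Ylam) _; rewrite ltrD2r.
apply: lt_le_trans (prefix_le_subset Y ds da).
by apply: maj; rewrite Y0 -ltnS prednK// (leq_ltn_trans _ Yn).
Qed.

Lemma diagonal_perm n (A : 'M[R[i]]_n) (d : n.-tuple R) :
  diagonal_listed A d -> perm_eq d [seq complex.Re (A i i) | i <- enum 'I_n].
Proof.
move=> /(perm_map (@complex.Re R)); rewrite -!map_comp.
by rewrite (eq_map (_ : _ =1 id)) ?map_id.
Qed.

(** Similar matrices share their characteristic polynomial, and a split polynomial determines its
    multiset of roots. *)
Lemma eigenvalues_perm n (A Q : 'M[R[i]]_n) (L : 'rV[R]_n) (lam : n.-tuple R) :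
  eigenvalues_listed A lam -> Q \is unitarymx ->
  A = Q *m real_diag_mx L *m Q^t* ->
  perm_eq lam [seq L 0 i | i <- enum 'I_n].
Proof.
move=> eA QU AQ.
have cA : char_poly A = char_poly (real_diag_mx L).
  have /unitarymxP QQ := QU; have Q2 := mulmx1C QQ.
  pose P := map_mx polyC Q; pose P' := map_mx polyC (Q^t*).
  have PP : P *m P' = 1%:M by rewrite -map_mxM QQ map_mx1.
  have -> : char_poly A = \det (P *m char_poly_mx (real_diag_mx L) *m P').
    congr (\det _); rewrite /char_poly_mx mulmxBr mulmxBl -!map_mxM -AQ.
    by rewrite scalar_mxC -mulmxA PP mulmx1.
  by rewrite !det_mulmx mulrAC -det_mulmx PP det1 mul1r.
have : perm_eq [seq x%:C | x <- lam] [seq x%:C | x <- [seq L 0 i | i <- enum 'I_n]].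
  apply: prod_XsubC_eq; rewrite [LHS]big_map 2![RHS]big_map [RHS]big_enum -eA cA.
  rewrite char_poly_trig.
    by apply: eq_bigr => i _; rewrite !mxE eqxx.
  exact/diag_mx_is_trig.
by move/(perm_map (@complex.Re R)); rewrite -!map_comp !(eq_map (_ : _ =1 id)) ?map_id.
Qed.

End Majorization.

(** * Rayleigh values in orthonormal bases and on diagonal blocks *)

Section Blocks.
Variables (R : realType) (n : nat).
Implicit Types (A B M Q : 'M[R[i]]_n) (u v w : 'rV[R[i]]_n) (c m : R).

Lemma Re_sum (I : finType) (F : I -> R[i]) (P : pred I) :
  complex.Re (\sum_(i | P i) F i) = \sum_(i | P i) complex.Re (F i).
Proof. by apply: (big_morph (@complex.Re R)) => // -[? ?] []. Qed.

Lemma rayleigh_sum (I : finType) (F : I -> 'M[R[i]]_n) (P : pred I) u :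
  rayleigh (\sum_(i | P i) F i) u = \sum_(i | P i) rayleigh (F i) u.
Proof. by rewrite /rayleigh mulmx_sumr mulmx_suml summxE Re_sum. Qed.

Lemma rayleighZ B c v : rayleigh B (c%:C *: v) = c ^+ 2 * rayleigh B v.
Proof.
rewrite /rayleigh; have -> : (c%:C *: v)^t* = c%:C *: v^t*.
  by apply/matrixP=> i j; rewrite !mxE rmorphM /= conjC_real.
rewrite -!scalemxAl -scalemxAr scalerA mxE -rmorphM -expr2.
by case: (_ 0 0) => a b /=; rewrite mul0r subr0.
Qed.

Lemma rayleigh_shift A m v : v *m v^t* = 1%:M ->
  rayleigh (A - (m%:C)%:M) v = rayleigh A v - m.
Proof.
move=> v1; rewrite /rayleigh mulmxBr mulmxBl mul_mx_scalar -scalemxAl v1.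
by rewrite mxE [X in _ + X]mxE ReB !mxE eqxx mulr1.
Qed.

Lemma normalize u : u != 0 ->
  exists c v, [/\ 0 < c, v *m v^t* = 1%:M & u = c%:C *: v].
Proof.
move=> u0; pose c := Num.sqrt (\sum_k normc (u 0 k) ^+ 2).
have uu : \sum_k u 0 k * (Num.conj (u 0 k)) = (c ^+ 2)%:C.
  rewrite sqr_sqrtr ?rmorph_sum; last by rewrite sumr_ge0// => k _; apply: sqr_ge0.
  by apply: eq_bigr => k _; rewrite -normCK normc_norm rmorphXn.
have c0 : 0 < c.
  rewrite lt_def sqrtr_ge0 andbT; apply: contra u0 => /eqP c0.
  apply/eqP/rowP=> k; rewrite mxE; apply: Normc.eq0_normc.
  move: c0 => /eqP; rewrite sqrtr_eq0 => c0.
  apply/eqP; rewrite -sqrf_eq0 eq_le sqr_ge0 andbT; apply: le_trans c0.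
  by rewrite (bigD1 k)//= lerDl sumr_ge0// => l _; apply: sqr_ge0.
have cC : c%:C != 0 by rewrite -(rmorph0 (real_complex R)) (inj_eq (@complexI R)) gt_eqF.
exists c, ((c^-1)%:C *: u); split=> //; last first.
  by rewrite scalerA -rmorphM divff ?scale1r// gt_eqF.
apply/matrixP=> i j; rewrite !ord1 !mxE eqxx.
under eq_bigr do rewrite !mxE rmorphM /= conjC_real mulrACA -rmorphM.
by rewrite -mulr_sumr uu -rmorphM -expr2 -exprMn mulVf ?expr1n// gt_eqF.
Qed.

Lemma sum_rayleigh_unitary M Q : Q \is unitarymx ->
  \sum_i rayleigh M (row i Q) = complex.Re (\tr M).
Proof.
move=> /unitarymxP/mulmx1C QQ; rewrite -[M in RHS]mulmx1 -QQ mulmxA mxtrace_mulC mulmxA.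
rewrite Re_sum; apply: eq_bigr => i _; congr complex.Re.
rewrite -row_mul !mxE; apply: eq_bigr => k _; rewrite !mxE; congr (_ * _).
Qed.

Lemma rayleigh_eigen A Q (L : 'rV[R]_n) i : Q \is unitarymx ->
  A = Q *m real_diag_mx L *m Q^t* -> rayleigh A (row i (Q^t*)) = L 0 i.
Proof.
move=> /unitarymxP/mulmx1C QQ AQ.
have : (Q^t* *m A *m Q) i i = (L 0 i)%:C.
  by rewrite AQ !mulmxA QQ mul1mx -mulmxA QQ mulmx1 !mxE eqxx.
rewrite /rayleigh => /(congr1 (@complex.Re R)) /= <-; congr complex.Re.
rewrite -row_mul !mxE; apply: eq_bigr => k _; rewrite !mxE conjCK; congr (_ * _).
Qed.

Section Decomposition.
Variables (T : finType) (r : 'I_n -> T).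

Definition block_proj l : 'M[R[i]]_n := diag_mx (\row_k (r k == l)%:R).

Lemma block_projE u l k : (u *m block_proj l) 0 k = u 0 k *+ (r k == l).
Proof. by rewrite mul_mx_diag !mxE mulr_natr. Qed.

Definition block l B := block_proj l *m B *m (block_proj l)^t*.

Lemma blockE l B j k : block l B j k = B j k *+ ((r j == l) && (r k == l)).
Proof.
rewrite /block; have -> : (block_proj l)^t* = block_proj l.
  apply/matrixP=> a b; rewrite !mxE [b == a]eq_sym rmorphMn rmorph_nat.
  by have [->|] := eqVneq a b.
rewrite mul_mx_diag mul_diag_mx !mxE.
by case: (r j == l); case: (r k == l); rewrite ?mul1r ?mulr1 ?mul0r ?mulr0.
Qed.

Lemma rayleigh_block l B u : rayleigh (block l B) u = rayleigh B (u *m block_proj l).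
Proof. by rewrite /rayleigh adjM /block !mulmxA. Qed.

(** [B] has no nonzero entry between different fibres of [r], hence is the sum of its diagonal
    blocks. *)
Lemma rayleigh_decomp B u : (forall j k, B j k != 0 -> r j = r k) ->
  rayleigh B u = \sum_l rayleigh B (u *m block_proj l).
Proof.
move=> Br; under eq_bigr do rewrite -rayleigh_block.
rewrite -rayleigh_sum; congr rayleigh; apply/matrixP=> j k; rewrite summxE.
under eq_bigr do rewrite blockE.
have [->|/Br ->] := eqVneq (B j k) 0; first by rewrite big1// => l _; rewrite mul0rn.
rewrite (bigD1 (r k))//= eqxx big1 ?addr0// => l lk.
by rewrite eq_sym (negPf lk).
Qed.

End Decomposition.
End Blocks.

(** * Connected components and strict majorization *)

Section Strong.
Variables (R : realType) (n : nat) (A : 'M[R[i]]_n).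
Hypothesis Ah : A^t* = A.

Definition edge : rel 'I_n := fun i j => A i j != 0.

Lemma edge_sym : connect_sym edge.
Proof.
apply: sym_connect_sym => i j; rewrite /edge -[in LHS]Ah !mxE.
by rewrite fmorph_eq0.
Qed.

Lemma reachable_connect i j : connect edge i j -> reachable A 1 (transfer i j).
Proof.
move=> /connectP[p]; elim: p i => [|k p IH] i /= => [_ ->|/andP[ik kp] jp].
  exact: reachable_refl.
apply: reachable_trans (IH _ kp jp).
have [->|ne] := eqVneq i k; first exact: reachable_refl.
exact: reachable_edge.
Qed.

Lemma reachable_root k :
  reachable A 1 (transfer k (fingraph.root edge k)) /\
  reachable A 1 (transfer (fingraph.root edge k) k).
Proof.
split; apply: reachable_connect; first exact: connect_root.
by rewrite edge_sym connect_root.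
Qed.

Lemma reachable_pair Q (L : 'rV[R]_n) (lam d : n.-tuple R) :
  Q \is unitarymx -> A = Q *m real_diag_mx L *m Q^t* ->
  eigenvalues_listed A lam -> diagonal_listed A d -> sorted <=%R d ->
  strict_majorization lam d ->
  forall i j, reachable A 2 (transfer i j).
Proof.
move=> QU AQ eA dA ds maj i0 j0; apply: contrapT => nij.
pose r := fingraph.root edge; have sym := edge_sym.
have rr k : r (r k) = r k by apply: root_root.
have root2 k : reachable A 2 (transfer k (r k)) /\ reachable A 2 (transfer (r k) k).
  have [k1 k2] := reachable_root k.
  by split; apply: reachable_lower => //; apply: increasing_transfer.
(* The indices from which [i0] cannot receive mass: a union of components that contains [j0] but not
   [i0]. *)
pose Y := [set k | ~~ `[< reachable A 2 (transfer i0 k) >]]%SET.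
have rY k : (r k \in Y) = (k \in Y).
  rewrite !inE; congr (~~ _); have [k1 k2] := root2 k.
  by apply/asboolP/asboolP => h; apply: reachable_trans h _.
have i0Y : i0 \notin Y by rewrite inE negbK; apply/asboolP; apply: reachable_refl.
have j0Y : j0 \in Y by rewrite inE; apply/asboolPn.
pose on_class p (v : 'rV[R[i]]_n) := v *m v^t* = 1%:M /\ forall k, v 0 k != 0 -> r k = r p.
have cross p q v w : p \notin Y -> q \in Y -> on_class p v -> on_class q w ->
    rayleigh A w <= rayleigh A v.
  (* A larger Rayleigh value at [q] would let [p] receive from [q], and then [i0] receive from [q]
     through [p]. *)
  move=> pY qY [v1 vp] [w1 wq]; rewrite leNgt; apply/negP => vw.
  move: (pY) (qY); rewrite !inE negbK => /asboolP i0p /asboolPn; apply.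
  apply: reachable_trans i0p _.
  apply: (@reachable_cross _ _ _ r p q v w reachable_root) => //.
  by apply/eqP => e; rewrite -rY e rY qY in pY.
have class_delta p : on_class p (delta_mx 0 p).
  split; first by rewrite delta_orthonormal eqxx.
  by move=> k; rewrite mxE eqxx /=; case: (eqVneq k p) => [->|]; rewrite ?eqxx.
(* The separating threshold is the supremum of the Rayleigh values on [Y]; the set is nonempty
   thanks to [j0] and bounded above thanks to [i0]. *)
pose S : set R := [set t | exists q w, [/\ q \in Y, on_class q w & t = rayleigh A w]]%classic.
pose m := sup S.
have Sj0 : (S !=set0)%classic.
  by exists (rayleigh A (delta_mx 0 j0)), j0, (delta_mx 0 j0).
have ubS p v : p \notin Y -> on_class p v -> ubound S (rayleigh A v).
  by move=> pY pv t [q [w [qY qw ->]]]; apply: cross pY qY pv qw.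
have mX p v : p \notin Y -> on_class p v -> m <= rayleigh A v.
  by move=> pY pv; apply: ge_sup => //; apply: ubS pY pv.
have mY q w : q \in Y -> on_class q w -> rayleigh A w <= m.
  move=> qY qw; apply: ub_le_sup; last by exists q, w.
  by exists (rayleigh A (delta_mx 0 i0)); apply: ubS i0Y (class_delta _).
pose B := A - (m%:C)%:M.
have Br j k : B j k != 0 -> r j = r k.
  have [->//|jk] := eqVneq j k; rewrite !mxE (negPf jk) subr0 => Ajk.
  by apply/eqP; rewrite root_connect//; apply: connect1.
(* The label [l] ranges over all indices; when it is not a root, its fibre is empty and the
   projection is 0. *)
have blockP u l : u *m block_proj R r l = 0 \/ exists c v,
    [/\ 0 < c, on_class l v & u *m block_proj R r l = c%:C *: v].
  have [->|] := eqVneq (u *m block_proj R r l) 0; first by left.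
  move=> /normalize[c [v [c0 v1 e]]]; right; exists c, v; split=> //; split=> // k vk.
  have : (u *m block_proj R r l) 0 k != 0.
    by rewrite e mxE mulf_neq0// -(rmorph0 (real_complex R)) (inj_eq (@complexI R)) gt_eqF.
  by rewrite block_projE; case: (eqVneq (r k) l) => [<-|]; rewrite ?rr// mulr0n eqxx.
have ray0 : rayleigh B 0 = 0 by rewrite /rayleigh !mul0mx mxE.
have BX u l : l \notin Y -> 0 <= rayleigh B (u *m block_proj R r l).
  move=> lY; have [->|[c [v [c0 [v1 vl] ->]]]] := blockP u l; first by rewrite ray0.
  by rewrite rayleighZ mulr_ge0 ?sqr_ge0// rayleigh_shift// subr_ge0 (mX l).
have BY u l : l \in Y -> rayleigh B (u *m block_proj R r l) <= 0.
  move=> lY; have [->|[c [v [c0 [v1 vl] ->]]]] := blockP u l; first by rewrite ray0.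
  by rewrite rayleighZ mulr_ge0_le0 ?sqr_ge0// rayleigh_shift// subr_le0 (mY l).
have Q'U : Q^t* \is unitarymx by rewrite trmxC_unitary.
(* At an eigenvector the block values add up to [L 0 i - m]; those in [Y] are nonpositive and the
   others nonnegative. *)
have key i : \sum_(l in Y) rayleigh B (row i (Q^t*) *m block_proj R r l) <=
    Num.min (L 0 i - m) 0.
  rewrite le_min; apply/andP; split; last by apply: sumr_le0 => l; apply: BY.
  have <- : rayleigh B (row i (Q^t*)) = L 0 i - m.
    rewrite rayleigh_shift ?(rayleigh_eigen _ QU AQ)//.
    apply/matrixP=> a b; rewrite !ord1; move/unitarymxP: Q'U.
    move=> /(congr1 (fun M : 'M[R[i]]_n => M i i)); rewrite !mxE eqxx => <-.
    by apply: eq_bigr => k _; rewrite !mxE.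
  rewrite (rayleigh_decomp _ Br) [leRHS](bigID (mem Y))/= lerDl.
  by apply: sumr_ge0 => l; apply: BX.
have card_Y : (0 < #|Y| < n)%N.
  apply/andP; split; first by apply/card_gt0P; exists j0.
  rewrite -[n in (_ < n)%N]card_ord -cardsT proper_card// properT.
  by apply/eqP => e; rewrite e inE in i0Y.
have := strict_majorization_gap m maj ds (eigenvalues_perm eA QU AQ)
  (diagonal_perm dA) card_Y.
rewrite ltNge => /negP; apply.
(* Summed over the eigenbasis, the left sides of [key] give the trace of [B] on [Y], which
   contradicts the strict gap. *)
apply: le_trans (ler_sum _ (fun i _ => key i)); rewrite exchange_big /=.
under [leRHS]eq_bigr => l lY do under eq_bigr => i _ do rewrite -rayleigh_block.
under [leRHS]eq_bigr => l lY do rewrite (sum_rayleigh_unitary _ Q'U) Re_sum.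
rewrite exchange_big /= (big_mkcond (mem Y)) /=; apply: ler_sum => k _.
under eq_bigr => l lY do rewrite blockE andbb.
have BkE : complex.Re (B k k) = complex.Re (A k k) - m.
  by rewrite mxE [X in _ + X]mxE ReB !mxE eqxx.
case: ifPn => kY.
  rewrite (bigD1 (r k)) ?rY//= eqxx mulr1n BkE big1 ?addr0// => l /andP[_ lk].
  by rewrite eq_sym (negPf lk).
rewrite big1// => l lY; case: eqP => // e.
by rewrite -e rY (negPf kY) in lY.
Qed.

(** All mass is routed through one index [o]: the constant map has a single nonempty fibre, whose
    balance is the zero-sum condition. For [n = 0] there is no [o], but also nothing to move. *)
Lemma reachable_total : (forall i j, reachable A 2 (transfer i j)) ->
  reachable A 2 (fun b x => (forall k, `|x 0 k| <= b) /\ \sum_k x 0 k = 0).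
Proof.
case: (posnP n) => [n0|n_gt0] H.
  apply: reachable0 => b x _; apply/rowP => k; have := ltn_ord k.
  by rewrite [X in (_ < X)%N]n0.
pose o := Ordinal n_gt0.
apply: reachable_sub (@reachable_routed _ _ A 2 (fun=> o) _) => //.
move=> b x [xb x0]; split=> //; apply: routed_decomp => l.
have [_|] := eqVneq o l; last by rewrite big_pred0_eq.
exact: x0.
Qed.

End Strong.

(** * Return to the Frobenius norm, and assembly *)

Lemma frobenius_norm_le (R : realType) m n (M : 'M[R[i]]_(m, n)) (b : R) :
  0 <= b -> entry_bound M b -> frobenius_norm M <= Num.sqrt (m%:R * n%:R) * b.
Proof.
move=> b0 Mb; rewrite -[X in _ * X](ger0_norm b0) -sqrtr_sqr -sqrtrM ?mulr_ge0//.
apply: ler_wsqrtr.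
apply: (@le_trans _ _ (\sum_(i < m) \sum_(j < n) b ^+ 2)).
  apply: ler_sum => i _; apply: ler_sum => j _.
  by rewrite ler_pXn2r ?nnegrE// normc_ge0.
by rewrite !sumr_const !card_ord -[leLHS]mulr_natl -[_ *+ n]mulr_natl mulrA.
Qed.

Lemma entry_bound_frobenius (R : realType) m n (M : 'M[R[i]]_(m, n)) :
  entry_bound M (frobenius_norm M).
Proof.
move=> i j; rewrite -(ger0_norm (normc_ge0 _)) -sqrtr_sqr ler_wsqrtr//.
rewrite (bigD1 i)//= (bigD1 j)//= -addrA lerDl addr_ge0 ?sumr_ge0// => k _.
  exact: sqr_ge0.
by apply: sumr_ge0 => l _; apply: sqr_ge0.
Qed.

Theorem proposition5p3 (R : realType) (n : nat) (A : 'M[R[i]]_n)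
    (lam d : n.-tuple R) :
  A \is hermsymmx ->
  eigenvalues_listed A lam -> sorted <=%R lam ->
  diagonal_listed A d -> sorted <=%R d ->
  strict_majorization lam d ->
  strongly_Schur_Horn_continuous A.
Proof.
move=> Aherm eA _ dA ds maj; split=> // Q L QU AQ Lt trL /eqO_exP[k k0 Ok].
have Ah : A^t* = A by apply/hermsymmxP.
have reach := reachable_total (reachable_pair Ah QU AQ eA dA ds maj).
pose C e := Q *m real_diag_mx (Lt e) *m Q^t*.
have diagh (l : 'rV[R]_n) : (real_diag_mx l)^t* = real_diag_mx l.
  apply/matrixP=> i j; rewrite !mxE [j == i]eq_sym rmorphMn /= conjC_real.
  by have [->|] := eqVneq i j.
have Ch e : (C e)^t* = C e by rewrite !adjM trmxCK diagh mulmxA.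
(* [C e - A] is [Q (Lt - L) Q^*]; each product with [Q], whose entries have modulus at most 1, costs
   a factor [n]. *)
pose M : R := n%:R * n%:R * k.
have M0 : 0 <= M by rewrite !mulr_ge0// ltW.
have [c [delta [c0 d0 H]]] := reach _ M0.
pose spec (e : R) U := [/\ U \is unitarymx, entry_bound (U - 1%:M) (c * Num.sqrt e) &
  diag_entries (U *m C e *m U^t*) = diag_entries A].
have exU : \forall e \near (0 : R)^'+%classic, exists U, spec e U.
  near=> e.
  have e0 : 0 < e by near: e; exact: nbhs_right_gt.
  have e1 : e < 1 by near: e; exact: nbhs_right_lt.
  have ed : e < delta ^+ 2 by near: e; apply: nbhs_right_lt; rewrite exprn_gt0.
  have eE : e = Num.sqrt e ^+ 2 by rewrite sqr_sqrtr// ltW.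
  have s0 : 0 < Num.sqrt e by rewrite sqrtr_gt0.
  have s1 : Num.sqrt e <= 1 by rewrite -(@expr_le1 _ 2)// -?eE; exact: ltW.
  have sd : Num.sqrt e < delta.
    by rewrite -(@ltr_pXn2r _ 2)// ?nnegrE -?eE//; exact: ltW.
  (* With [eta = Num.sqrt e], this bound serves twice: weakened to [O(eta)] as the distance to [A],
     and in full as the size of the diagonal error. *)
  have CAe : entry_bound (C e - A) (M * Num.sqrt e ^+ 2).
    have Fe : frobenius_norm (real_diag_mx (Lt e) - real_diag_mx L) <= k * e.
      have : `|frobenius_norm (real_diag_mx (Lt e) - real_diag_mx L)| <= k * `|e|.
        by near: e.
      by rewrite (ger0_norm (sqrtr_ge0 _)) (gtr0_norm e0).
    have Fb := entry_boundW Fe (entry_bound_frobenius _).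
    have -> : C e - A = Q *m (real_diag_mx (Lt e) - real_diag_mx L) *m Q^t*.
      by rewrite mulmxBr mulmxBl -AQ.
    have Qb := entry_bound_unitary QU.
    apply: entry_boundW (entry_boundM (entry_boundM Qb Fb) (entry_bound_adj Qb)).
    by rewrite -eE /M; lra.
  pose x : 'rV[R]_n := \row_j complex.Re ((A - C e) j j).
  have xE j : x 0 j = complex.Re ((A - C e) j j) by rewrite mxE.
  have [||||U [UU Uc Ux]] := H (Num.sqrt e) (C e) x.
  - by rewrite s0.
  - exact: Ch.
  - apply: entry_boundW CAe; rewrite ler_wpM2l// expr2 ler_piMr//; exact: ltW.
  - split=> [j|].
      rewrite xE (le_trans (Re_le_normc _))//.
      by have /(_ j j) := entry_boundN CAe; rewrite opprB.
    (* The displacement sums to zero because unitary conjugation preserves traces and [Lt e] has the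
       trace of [L]. *)
    under eq_bigr do rewrite xE.
    rewrite -Re_sum -/(\tr (A - C e)) raddfB /=.
    have -> : \tr A = \tr (real_diag_mx L).
      have /unitarymxP/mulmx1C QQ := QU.
      by rewrite AQ -mulmxA mxtrace_mulC -mulmxA QQ mulmx1.
    have -> : \tr (C e) = \tr (real_diag_mx (Lt e)).
      have /unitarymxP/mulmx1C QQ := QU.
      by rewrite /C -mulmxA mxtrace_mulC -mulmxA QQ mulmx1.
    suff -> : \tr (real_diag_mx (Lt e)) = \tr (real_diag_mx L) by rewrite subrr.
    by near: e.
  exists U; split=> //; apply/rowP=> j; rewrite [LHS]mxE [RHS]mxE Ux xE.
  rewrite hermitian_diag; last by rewrite adjB Ah Ch.
  by rewrite [(A - C e) j j]mxE [(- C e) j j]mxE; ring.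
(* A family is a total function of [e]; the identity is the default where no correcting unitary
   exists, which does not happen for small [e > 0]. *)
have /choice[G2 G2P] : forall e, exists U, (exists V, spec e V) -> spec e U.
  move=> e; have [[U eU]|nU] := pselect (exists U, spec e U); first by exists U.
  by exists 1%:M.
exists (fun=> 1%:M), G2; split.
- near=> e.
  have [UU Uc Ud] : spec e (G2 e) by apply: G2P; near: e.
  split; [by apply/unitarymxP; rewrite adj1 mulmx1|exact: UU|].
  have -> : G2 e *m Q *m 1%:M *m real_diag_mx (Lt e) *m (1%:M)^t* *m Q^t* *m (G2 e)^t*
      = G2 e *m C e *m (G2 e)^t* by rewrite adj1 !mulmx1 /C !mulmxA.
  split; last exact: Ud.
  by apply/hermsymmxP; rewrite 2!adjM trmxCK Ch mulmxA.
- apply/eqO_exP; exists 1 => //; near=> e; rewrite subrr mul1r.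
  suff -> : frobenius_norm (0 : 'M[R[i]]_n) = 0 by rewrite normr0.
  rewrite /frobenius_norm big1 ?sqrtr0// => i _; rewrite big1// => j _.
  by rewrite mxE Normc.normc0 expr0n.
(* Adding 1 keeps the constant positive, since [c] may be 0. *)
- apply/eqO_exP; exists (Num.sqrt (n%:R * n%:R) * c + 1).
    by rewrite ltr_wpDl// mulr_ge0// sqrtr_ge0.
  near=> e; have [UU Uc Ud] : spec e (G2 e) by apply: G2P; near: e.
  rewrite !(ger0_norm (sqrtr_ge0 _)).
  apply: le_trans (frobenius_norm_le _ Uc) _; first by rewrite mulr_ge0// sqrtr_ge0.
  by rewrite mulrA mulrDl lerDl mul1r sqrtr_ge0.
Unshelve. all: by end_near.
Qed.
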